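(* For any norm $\|\cdot\|$ on $\mathbb{R}^2$, there exist $\ell>0$ and a curve (continuous mapping) $\gamma:[0,\ell]\to(\mathbb{R}^2,\|\cdot\|)$ with $md(\gamma,x)=1$ for all $x\in[0,\ell]$, such that the set of points of $[0,\ell]$ where $\gamma$ is not metrically differentiable is uncountable.
   Context: For a mapping $f:[a,b]\to X$ into a normed space $X$, the unilateral metric derivatives are $md_{\pm}(f,x)=\lim_{t\to0+}\frac{\|f(x\pm t)-f(x)\|}{t}$. If both exist and are equal (and finite), their common value is the metric derivative $md(f,x)$; at an endpoint of $[a,b]$ only the one-sided limit taken inside $[a,b]$ is used. The mapping $f$ is metrically differentiable at $x$ if $md(f,x)$ exists and $\|f(y)-f(z)\|-md(f,x)|y-z|=o(|y-x|+|z-x|)$ as $(y,z)\to(x,x)$ with $y,z\in[a,b]$. *)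

(* Defs.v *)
From HB Require Import structures.
From mathcomp Require Import all_boot all_order all_algebra.
From mathcomp Require Import all_classical all_reals all_analysis.

Set Implicit Arguments.
Unset Strict Implicit.
Unset Printing Implicit Defensive.

Import Order.TTheory GRing.Theory Num.Theory.
Import numFieldNormedType.Exports.

Local Open Scope classical_set_scope.
Local Open Scope ring_scope.

(* [N] is an arbitrary norm on the vector space [V]. When [V] is ['rV[R]_2],
   it is in general not the library's (sup) norm [`|v|]. *)
Record is_norm (R : realType) (V : lmodType R) (N : V -> R) : Prop := IsNorm {
  isnorm_ge0 : forall v : V, 0 <= N v ;
  isnorm_eq0 : forall v : V, N v = 0 -> v = 0 ;
  isnormZ : forall (c : R) (v : V), N (c *: v) = `|c| * N v ;
  isnorm_triangle : forall u v : V, N (u + v) <= N u + N v }.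

(* A mapping [[a, b] -> V] is given as a total function on [R]; the notions
   below, at points [x] of [[a, b]], only depend on its values on [[a, b]]. *)
Section MetricDerivative.
Context {R : realType} {V : lmodType R} (N : V -> R) (a b : R) (f : R -> V).

Definition norm_continuous_on : Prop :=
  forall x : R, x \in `[a, b] ->
    N (f y - f x) @[y --> within [set` `[a, b]] (nbhs x)] --> (0 : R).

Definition is_mdr (x m : R) : Prop :=
  N (f (x + t) - f x) / t @[t --> 0^'+] --> m.

Definition is_mdl (x m : R) : Prop :=
  N (f (x - t) - f x) / t @[t --> 0^'+] --> m.

(* [md(f, x)] exists and equals [m]. At [x = a] (resp. [x = b]) only the right
   (resp. left) limit is required. *)
Definition is_md (x m : R) : Prop :=
  (x < b -> is_mdr x m) /\ (a < x -> is_mdl x m).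

Definition metrically_differentiable (x : R) : Prop :=
  exists2 m : R, is_md x m &
    (fun yz : R * R => N (f yz.1 - f yz.2) - m * `|yz.1 - yz.2| : R^o)
    =o_ (within ([set` `[a, b]] `*` [set` `[a, b]]) (nbhs (x, x)))
    (fun yz : R * R => `|yz.1 - x| + `|yz.2 - x| : R^o).

End MetricDerivative.

(* Main.v *)
Require Import Defs.
From HB Require Import structures.
From mathcomp Require Import all_boot all_order all_algebra.
From mathcomp Require Import all_classical all_reals all_analysis.
From mathcomp Require Import measurable_realfun ring lra zify.
Import Order.TTheory GRing.Theory Num.Theory.
Import numFieldNormedType.Exports.
Local Open Scope classical_set_scope.
Local Open Scope ring_scope.

(**
  The curve is the primitive of a piecewise constant field of unit vectors that
  equals [w0] most of the time. The intervals left over by the pieces shrink to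
  a Cantor set: an interval of stage [k] contains two intervals of stage
  [k.+1], one at each end, and the gap between them is cut at geometrically
  growing distances from its left end, with ratio [k.+2]. Along these pieces
  the direction moves from [w0] to a vector [v] with [N (w0 + v) <= 1] and back,
  by steps of order [1 / k.+2].

  Seen from a point of the Cantor set, each scale is dominated by one piece or
  by two consecutive pieces with nearly equal directions, so both one-sided
  metric derivatives are 1. If the point lies in a left interval of stage
  [k.+2] inside a right interval of stage [k.+1] for infinitely many [k], then
  the curve has, at infinitely many scales, direction [w0] before the point and
  [v] after it; such a corner contradicts metric differentiability. A diagonal
  choice of nested intervals shows that there are uncountably many such points.
*)

(** * Norms and arcs of unit vectors *)

Section NormFacts.
Context {R : realType} {V : lmodType R} {N : V -> R}.
Hypothesis hN : is_norm N.

Lemma isnorm0 : N 0 = 0.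
Proof. by rewrite -(scale0r 0) (isnormZ hN) normr0 mul0r. Qed.

Lemma isnormN v : N (- v) = N v.
Proof. by rewrite -scaleN1r (isnormZ hN) normrN1 mul1r. Qed.

Lemma isnorm_distC u v : N (u - v) = N (v - u).
Proof. by rewrite -isnormN opprB. Qed.

Lemma isnormB u v : N u - N v <= N (u - v).
Proof. by have := isnorm_triangle hN (u - v) v; rewrite subrK; lra. Qed.

Lemma isnorm_dist u v : `|N u - N v| <= N (u - v).
Proof.
by rewrite ler_norml; have := isnormB u v; have := isnormB v u;
   rewrite (isnorm_distC v u); lra.
Qed.

Lemma isnorm_gt0 v : v != 0 -> 0 < N v.
Proof.
by move=> v0; rewrite lt0r (isnorm_ge0 hN) andbT; apply: contra v0 => /eqP/(isnorm_eq0 hN)->.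
Qed.

Definition unitize (v : V) : V := (N v)^-1 *: v.

Lemma isnorm_unitize v : v != 0 -> N (unitize v) = 1.
Proof.
move=> /isnorm_gt0 v0; rewrite (isnormZ hN) gtr0_norm ?invr_gt0// mulVf//.
exact: lt0r_neq0.
Qed.

Lemma unitize_lipschitz u v : u != 0 -> v != 0 ->
  N (unitize u - unitize v) <= 2 * N (u - v) / N v.
Proof.
move=> u0 v0; have Nu := isnorm_gt0 _ u0; have Nv := isnorm_gt0 _ v0.
have -> : unitize u - unitize v =
    (N v)^-1 *: (u - v) + ((N u)^-1 - (N v)^-1) *: u.
  by rewrite /unitize scalerBr scalerBl [RHS]addrC addrA subrK.
apply: le_trans (isnorm_triangle hN _ _) _; rewrite !(isnormZ hN).
have -> : (N u)^-1 - (N v)^-1 = (N u * N v)^-1 * (N v - N u).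
  by field; rewrite !lt0r_neq0.
rewrite normrM [`|(N v)^-1|]gtr0_norm ?invr_gt0//.
rewrite [`|(_ * _)^-1|]gtr0_norm ?invr_gt0 ?mulr_gt0//.
rewrite [leRHS](_ : _ = (N v)^-1 * N (u - v) + (N u * N v)^-1 * N (u - v) * N u).
  rewrite lerD2l ler_pM2r// ler_pM2l ?invr_gt0 ?mulr_gt0//.
  by rewrite distrC isnorm_dist.
by field; rewrite !lt0r_neq0.
Qed.

End NormFacts.

Section UnitArc.
Context {R : realType} {V : lmodType R} {N : V -> R}.
Hypothesis hN : is_norm N.
Variables (e v : V).
Hypotheses (Ne : N e = 1) (Nv : N v = 1) (ev0 : e + v != 0).

Definition chord (x : R) : V := (1 - x) *: e + x *: v.

Lemma chordB x y : chord x - chord y = (x - y) *: (v - e).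
Proof.
have chordE z : chord z = e + z *: (v - e).
  by rewrite /chord scalerBl scale1r scalerBr addrAC -addrA.
by rewrite !chordE opprD addrACA subrr add0r -scalerBl.
Qed.

Lemma isnorm_chordB x y : N (chord x - chord y) <= 2 * `|x - y|.
Proof.
rewrite chordB (isnormZ hN) mulrC ler_wpM2r//.
by apply: le_trans (isnorm_triangle hN _ _) _; rewrite (isnormN hN) Ne Nv.
Qed.

(** The reverse triangle inequality gives [|1 - 2 x| <= N (chord x)], and [chord x] is within
    [|1 - 2 x|] of [(e + v) / 2]. Averaging the two lower bounds gives the quarter. *)
Lemma isnorm_chord x : 0 <= x <= 1 -> N (e + v) / 4 <= N (chord x).
Proof.
move=> /andP[x0 x1].
have h1 := isnormB hN ((1 - x) *: e) (- (x *: v)).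
have h2 := isnormB hN (x *: v) (- ((1 - x) *: e)).
rewrite !opprK !(isnormN hN) !(isnormZ hN) Ne Nv [x *: v + _]addrC in h1 h2.
rewrite !ger0_norm in h1 h2; [|lra..].
rewrite -/(chord x) in h1 h2.
have h3 : N (e + v) / 2 = N (chord 2^-1).
  have -> : chord 2^-1 = 2^-1 *: (e + v).
    by rewrite /chord scalerDr (_ : 1 - 2^-1 = 2^-1 :> R)//; field.
  by rewrite (isnormZ hN) gtr0_norm ?invr_gt0// mulrC.
have := isnormB hN (chord 2^-1) (chord x); have := isnorm_chordB 2^-1 x.
rewrite -h3.
case: (lerP x 2^-1) => hx; lra.
Qed.

Lemma chord_neq0 x : 0 <= x <= 1 -> chord x != 0.
Proof.
move=> /isnorm_chord h; apply/eqP => c0; move: h; rewrite c0 (isnorm0 hN).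
by have := isnorm_gt0 hN _ ev0; lra.
Qed.

Definition unit_arc (x : R) : V := unitize (N := N) (chord x).

Lemma isnorm_unit_arc x : 0 <= x <= 1 -> N (unit_arc x) = 1.
Proof. by move=> /chord_neq0 /(isnorm_unitize hN). Qed.

Lemma unit_arc0 : unit_arc 0 = e.
Proof. by rewrite /unit_arc /unitize /chord subr0 scale0r addr0 scale1r Ne invr1 scale1r. Qed.

Lemma unit_arc1 : unit_arc 1 = v.
Proof. by rewrite /unit_arc /unitize /chord subrr scale0r add0r scale1r Nv invr1 scale1r. Qed.

Lemma unit_arc_lipschitz x y : 0 <= x <= 1 -> 0 <= y <= 1 ->
  N (unit_arc x - unit_arc y) <= 16 / N (e + v) * `|x - y|.
Proof.
move=> x01 y01; have ev := isnorm_gt0 hN _ ev0.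
apply: le_trans (unitize_lipschitz hN _ _ (chord_neq0 _ x01) (chord_neq0 _ y01)) _.
have cy := isnorm_chord _ y01.
have cy0 : 0 < N (chord y) by lra.
rewrite ler_pdivrMr//.
apply: (@le_trans _ _ (4 * `|x - y|)); first by have := isnorm_chordB x y; lra.
apply: (@le_trans _ _ (16 / N (e + v) * `|x - y| * (N (e + v) / 4))).
  by rewrite le_eqVlt; apply/orP; left; apply/eqP; field; rewrite lt0r_neq0.
by rewrite ler_wpM2l// mulr_ge0// divr_ge0// ltW.
Qed.

End UnitArc.

(** For independent unit vectors [e], [f] with [m = N (f - e) >= 1], normalizing [f - e] to [v]
    makes [e + v] a convex combination of [e] and [f]. *)
Lemma unit_pair_sum_le1 (R : realType) (N : 'rV[R]_2 -> R) : is_norm N ->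
  exists e v : 'rV[R]_2, [/\ N e = 1, N v = 1, e + v != 0 & N (e + v) <= 1].
Proof.
move=> hN.
pose b0 : 'rV[R]_2 := delta_mx 0 0; pose b1 : 'rV[R]_2 := delta_mx 0 1.
have b00 : b0 != 0.
  by apply/eqP => /rowP/(_ 0); rewrite !mxE !eqxx/= => /eqP; rewrite oner_eq0.
have b10 : b1 != 0.
  by apply/eqP => /rowP/(_ 1); rewrite !mxE !eqxx/= => /eqP; rewrite oner_eq0.
have [e [Ne e1]] : exists e : 'rV[R]_2, N e = 1 /\ e 0 1 = 0.
  exists (unitize (N := N) b0); split; first exact: isnorm_unitize.
  by rewrite !mxE/= mulr0.
(* Of [N (f - e)] and [N (- f - e)], whose sum is at least [N (2 e)], one is at least 1. *)
have [f [Nf f1 fe]] : exists f : 'rV[R]_2, [/\ N f = 1, f 0 1 != 0 & 1 <= N (f - e)].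
  pose f := unitize (N := N) b1.
  have Nf : N f = 1 by exact: isnorm_unitize.
  have f1 : f 0 1 != 0.
    by rewrite !mxE/= mulr1 invr_eq0 lt0r_neq0// isnorm_gt0.
  have [h|h] := lerP 1 (N (f - e)); first by exists f.
  exists (- f); split; rewrite ?(isnormN hN)//; first by rewrite mxE oppr_eq0.
  have := isnormB hN (2 *: e) (e - f).
  have -> : 2 *: e - (e - f) = - (- f - e).
    by rewrite scaler_nat mulr2n opprB opprD !opprK addrCA addrK.
  rewrite (isnorm_distC hN e) (isnormZ hN) Ne (isnormN hN) ger0_norm//; lra.
pose m := N (f - e); have m0 : 0 < m by exact: lt_le_trans fe.
pose v := m^-1 *: (f - e).
have Nv : N v = 1 by rewrite (isnormZ hN) gtr0_norm ?invr_gt0// mulVf// lt0r_neq0.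
exists e, v; split=> //.
  apply/eqP => /rowP/(_ 1); rewrite !mxE e1 subr0 add0r => /eqP.
  by rewrite mulf_eq0 invr_eq0 (negbTE f1) orbF; apply/negP/lt0r_neq0.
have -> : e + v = (1 - m^-1) *: e + m^-1 *: f.
  by rewrite /v scalerBr scalerBl scale1r addrC -addrA addrC [- _ + _]addrC.
apply: le_trans (isnorm_triangle hN _ _) _.
have m1 : m^-1 <= 1 by rewrite invf_le1.
have mi0 : 0 <= m^-1 by rewrite invr_ge0 ltW.
by rewrite !(isnormZ hN) Ne Nf !mulr1 !ger0_norm ?subr_ge0// subrK.
Qed.

(** * Primitives of step functions *)

Section StepPrimitive.
Context {R : realType} {T : countType} (A : T -> set R).
Hypothesis mA : forall a, measurable (A a).
Hypothesis dA : forall a b x, A a x -> A b x -> a = b.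

(** Since the index type is countable, a preimage is a countable union of sets [A a], plus possibly
    the complement of all of them, where [u] is 0. *)
Lemma measurable_step (v : T -> R) : exists u : R -> R,
  [/\ measurable_fun setT u, forall a x, A a x -> u x = v a &
      forall x, u x = 0 \/ exists a, u x = v a].
Proof.
pose u x := match pselect (exists a, A a x) with
            | left h => v (projT1 (cid h)) | right _ => 0 end.
have uE a x : A a x -> u x = v a.
  move=> Aax; rewrite /u; case: pselect => [h|]; last by case; exists a.
  by congr v; apply: dA (projT2 (cid h)) Aax.
have u0 x : ~ (exists a, A a x) -> u x = 0 by rewrite /u; case: pselect.
exists u; split=> //; last first.
  move=> x; have [[a Aax]|/u0] := pselect (exists a, A a x); last by left.
  by right; exists a; exact: uE.
move=> _ B mB; rewrite setTI.
have -> : u @^-1` B = (\bigcup_a (A a `&` [set x | B (v a)])) `|`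
                      ((~` \bigcup_a A a) `&` [set x | B 0]).
  apply/seteqP; split=> x /=.
    have [[a Aax]|na] := pselect (exists a, A a x).
      by rewrite (uE _ _ Aax) => Bv; left; exists a.
    rewrite (u0 _ na) => B0; right; split=> //.
    by move=> [a _ Aax]; apply: na; exists a.
  case=> [[a _ [Aax Bv]]|[na B0]]; first by rewrite /= (uE _ _ Aax).
  by rewrite u0//; move=> [a Aax]; apply: na; exists a.
have mP (P : Prop) : measurable [set x : R | P].
  by have [p|p] := pselect P; [rewrite (_ : mkset _ = setT)|rewrite (_ : mkset _ = set0)];
    rewrite ?predeqE.
have cT : countable [set: T] by exact: countableP.
apply: measurableU.
  by apply: countable_bigcupT_measurable => // a; apply: measurableI.
apply: measurableI => //; apply: measurableC.
exact: countable_bigcupT_measurable.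
Qed.

Lemma exists_step_primitive (v : T -> R) (M : R) :
  0 <= M -> (forall a, `|v a| <= M) ->
  exists g : R -> R,
    (forall s t, 0 <= s <= t -> `|g t - g s| <= M * (t - s)) /\
    (forall a s t, 0 <= s <= t -> (forall x, s <= x < t -> A a x) ->
      g t - g s = (t - s) * v a).
Proof.
move=> M0 vM; have [u [mu uE u0]] := measurable_step v.
have uM x : `|u x| <= M by case: (u0 x) => [->|[a ->]//]; rewrite normr0.
pose g t := \int[lebesgue_measure]_(x in `[0, t]) u x.
have len s t : s <= t ->
    fine (lebesgue_measure ([set` `[s, t[ ] : set R)) = t - s.
  move=> st; rewrite lebesgue_measure_itv/= lte_fin.
  by case: ltP => // ts; rewrite (@le_anti _ _ s t) ?st// subrr.
have iu (f : R -> R) b1 b2 s t : measurable_fun setT f ->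
    (forall x, `|f x| <= M) ->
    lebesgue_measure.-integrable [set` Interval (BSide b1 s) (BSide b2 t)]
      (EFin \o f).
  move=> mf fM; apply: measurable_bounded_integrable => //.
  - rewrite /= lebesgue_measure_itv/=; case: ifP => // _.
    by rewrite -EFinB ltry.
  - exact: measurable_funTS.
  - exists M; split; first exact: num_real.
    by move=> m Mm x _ /=; exact: le_trans (fM x) (ltW Mm).
have gB s t : 0 <= s <= t -> g t - g s = \int[lebesgue_measure]_(x in `[s, t[) u x.
  move=> /andP[s0 st]; rewrite /g Rintegral_itvB ?bnd_simp//; last exact: iu.
  rewrite Rintegral_itv_obnd_cbnd; last exact: iu.
  by rewrite Rintegral_itv_bndo_bndc//; exact: iu.
exists g; split=> [s t|a s t] /[dup] h /andP[_ st].
  rewrite gB// -(len _ _ st) -(Rintegral_cst lebesgue_measure)//.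
  apply: le_trans (le_normr_Rintegral _ _) _ => //; first exact: iu.
  apply: le_Rintegral => //.
    by apply: iu => [|x]; [exact: measurableT_comp|rewrite normr_id].
  by apply: iu => // x; rewrite ger0_norm.
move=> Aa; rewrite gB// -(len _ _ st) mulrC -(Rintegral_cst lebesgue_measure)//.
apply: eq_Rintegral => x; rewrite inE /= in_itv/= => xst.
exact/uE/Aa.
Qed.

End StepPrimitive.

Lemma exists_step_curve {R : realType} {T : countType} {n : nat}
    (A : T -> set R) (v : T -> 'rV[R]_n) (M : R) :
  (forall a, measurable (A a)) -> (forall a b x, A a x -> A b x -> a = b) ->
  0 <= M -> (forall a i, `|v a 0 i| <= M) ->
  exists g : R -> 'rV[R]_n,
    (forall s t i, 0 <= s <= t -> `|(g t - g s) 0 i| <= M * (t - s)) /\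
    (forall a s t, 0 <= s <= t -> (forall x, s <= x < t -> A a x) ->
      g t - g s = (t - s) *: v a).
Proof.
move=> mA dA M0 vM.
have [G hG] := choice (fun i : 'I_n =>
  exists_step_primitive A mA dA (fun a => v a 0 i) M M0 (vM^~ i)).
exists (fun t => \row_i G i t); split=> [s t i st|a s t st Aa].
  by rewrite !mxE; apply: (hG i).1.
by apply/rowP => i; rewrite !mxE; apply: (hG i).2.
Qed.

(** * The Cantor scheme *)

Section Scheme.
Context (R : realType).

(* At stage [k] the left interval is [c, c + width k.+1], the pieces of the gap are
   [c + brk k j, c + brk k j.+1] for [j <= last_piece k], and the right interval
   is [c + gap_end k, c + width k]. *)
Definition growth (k : nat) : R := k.+2%:R.

(** Twice [k.+2], so that the index [k.+2], where the direction is [v], lies halfway. *)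
Definition last_piece (k : nat) : nat := k.+2.*2.

(** The denominator is chosen so that [gap_end k + width k.+1 = width k]. *)
Fixpoint width (k : nat) : R :=
  if k is k'.+1 then width k' / (growth k' ^+ (last_piece k').+1 + 1) else 1.

Definition brk (k j : nat) : R := growth k ^+ j * width k.+1.

Definition gap_end (k : nat) : R := brk k (last_piece k).+1.

Inductive node : nat -> R -> Prop :=
| node0 : node 0 0
| nodeL k c : node k c -> node k.+1 c
| nodeR k c : node k c -> node k.+1 (c + gap_end k).

Lemma growth_ge2 k : 2 <= growth k.
Proof. by rewrite /growth (ler_nat R 2). Qed.

Lemma growth_gt0 k : 0 < growth k. Proof. by rewrite /growth ltr0n. Qed.

Lemma growth_ge1 k : 1 <= growth k. Proof. by have := growth_ge2 k; lra. Qed.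

Lemma width_gt0 k : 0 < width k.
Proof.
elim: k => //= k IH; rewrite divr_gt0// ltr_wpDl// exprn_ge0//.
Qed.

Lemma brk0 k : brk k 0 = width k.+1.
Proof. by rewrite /brk expr0 mul1r. Qed.

Lemma brkS k j : brk k j.+1 = growth k * brk k j.
Proof. by rewrite /brk exprS mulrA. Qed.

Lemma brk_gt0 k j : 0 < brk k j.
Proof. by rewrite mulr_gt0 ?width_gt0// exprn_gt0// growth_gt0. Qed.

Lemma le_brk k i j : (i <= j)%N -> brk k i <= brk k j.
Proof.
by move=> ij; rewrite /brk ler_pM2r ?width_gt0// ler_weXn2l// growth_ge1.
Qed.

Lemma width_brk k j : width k.+1 <= brk k j.
Proof. by rewrite -brk0 le_brk. Qed.

Lemma brkS_ge2 k j : 2 * brk k j <= brk k j.+1.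
Proof. by rewrite brkS ler_pM2r ?brk_gt0// growth_ge2. Qed.

Lemma widthE k : width k = gap_end k + width k.+1.
Proof.
have h : 0 < growth k ^+ (last_piece k).+1 + 1.
  by rewrite ltr_wpDl// exprn_ge0// ltW// growth_gt0.
rewrite /gap_end /brk -[X in _ = _ + X]mul1r -mulrDl /= mulrC divfK//.
exact: lt0r_neq0.
Qed.

Lemma gap_end_gt0 k : 0 < gap_end k. Proof. exact: brk_gt0. Qed.

Lemma width_lt_gap_end k : 2 * width k.+1 <= gap_end k.
Proof. by apply: le_trans (brkS_ge2 k _); have := width_brk k (last_piece k); lra. Qed.

Lemma widthS_le k : width k.+1 <= width k.
Proof. by rewrite (widthE k); have := gap_end_gt0 k; lra. Qed.

(** Widths at least halve, so [width k * k.+1%:R] stays at most 1. The form [k + n] suits later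
    inductions, which lower [n] while raising [k]. *)
Lemma width_small (e : R) : 0 < e -> exists n, forall k, width (k + n) < e.
Proof.
move=> e0.
have h k : width k * k.+1%:R <= 1.
  elim: k => [|k IH]; first by rewrite mul1r.
  have w0 := width_gt0 k.+1.
  have : 2 * width k.+1 <= width k by rewrite (widthE k); have := width_lt_gap_end k; lra.
  have : (1 : R) <= k.+1%:R by rewrite (ler_nat R 1).
  move=> k1 h2; apply: le_trans IH.
  apply: (@le_trans _ _ (2 * width k.+1 * k.+1%:R)); last by rewrite ler_pM2r ?ltr0n.
  rewrite -natr1 mulrDr mulr1 -mulrA mulrDl mul1r lerD2l.
  by rewrite ler_peMr// ltW.
exists (Num.truncn e^-1) => k.
have hk := h (k + Num.truncn e^-1)%N.
have hn : e^-1 < (k + Num.truncn e^-1).+1%:R.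
  by apply: lt_le_trans (truncnS_gt _) _; rewrite ler_nat ltnS leq_addl.
rewrite -(ltr_pM2r (x := (k + Num.truncn e^-1).+1%:R)) ?ltr0n//.
apply: le_lt_trans hk _; rewrite mulrC -ltr_pdivrMr// mul1r//.
Qed.

Lemma node_bounds k c : node k c -> 0 <= c /\ c + width k <= 1.
Proof.
elim=> [|{}k {}c _ [c0 c1]|{}k {}c _ [c0 c1]]; first by rewrite add0r.
  by split=> //; have := widthS_le k; lra.
by split; [have := gap_end_gt0 k; lra|rewrite (widthE k) in c1; lra].
Qed.

Lemma brk_locate k (c x : R) n : c + brk k 0 <= x < c + brk k n ->
  exists2 j, (j < n)%N & c + brk k j <= x < c + brk k j.+1.
Proof.
elim: n => [|n IH] /andP[h1 h2]; first lra.
case: (ltP x (c + brk k n)) => h; last by exists n; rewrite ?ltnSn ?h.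
by case: IH => [|j jn hj]; [rewrite h1|exists j => //; exact: ltnW].
Qed.

Lemma brk_locate_left k (c x : R) n : c + brk k 0 < x <= c + brk k n ->
  exists2 j, (j < n)%N & c + brk k j < x <= c + brk k j.+1.
Proof.
elim: n => [|n IH] /andP[h1 h2]; first lra.
case: (leP x (c + brk k n)) => h; last by exists n; rewrite ?ltnSn ?h.
by case: IH => [|j jn hj]; [rewrite h1|exists j => //; exact: ltnW].
Qed.

(* Distance to the left end of the interval of stage [k] containing [x]; junk
   when [x] already lies in a gap of an earlier stage. *)
Fixpoint offset (k : nat) (x : R) : R :=
  if k is k'.+1 then
    if gap_end k' <= offset k' x then offset k' x - gap_end k' else offset k' x
  else x.

(** The pieces of index [j] of all intervals of stage [k] are taken together, as the direction
    depends on [(k, j)] only. The bounds on the offsets rule out junk: a point of a gap has offset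
    at least the width of the next stage. *)
Definition piece (p : nat * nat) : set R :=
  [set x | (p.2 <= last_piece p.1)%N /\
           (forall i, (i <= p.1)%N -> offset i x < width i) /\
           brk p.1 p.2 <= offset p.1 x < brk p.1 p.2.+1].

Lemma measurable_offset k : measurable_fun setT (offset k).
Proof.
elim: k => [|k IH]/=; first exact: measurable_id.
apply: measurable_fun_ifT => //; first exact: measurable_fun_ler.
exact: measurable_funD.
Qed.

Lemma measurable_piece p : measurable (piece p).
Proof.
have mo k (i : interval R) : measurable (offset k @^-1` [set` i]).
  by rewrite -[X in measurable X]setTI; apply: measurable_offset.
have [hp|hp] := boolP (p.2 <= last_piece p.1)%N; last first.
  by rewrite (_ : piece p = set0)// predeqE => x; split=> // -[]; rewrite (negbTE hp).
rewrite (_ : piece p = (\bigcap_(i in `I_p.1.+1) offset i @^-1` `]-oo, width i[) `&`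
   (offset p.1 @^-1` `[brk p.1 p.2, brk p.1 p.2.+1[)).
  apply: measurableI => //.
  by apply: bigcap_measurable => //; exists 0%N.
apply/seteqP; split=> x.
  move=> [_ [h1 h2]]; split; last by rewrite /= in_itv.
  by move=> i ip /=; rewrite in_itv/= h1.
move=> [h1]; rewrite /= in_itv/= => h2; split=> //; split.
Qed.

(** At equal stages the breakpoints separate the pieces. A point in a gap of stage [k] keeps its
    offset at stage [k.+1], where it is too large for any later piece. *)
Lemma piece_inj p q (x : R) : piece p x -> piece q x -> p = q.
Proof.
wlog : p q / (p.1 <= q.1)%N => [H px qx|].
  by case: (leqP p.1 q.1) => [|/ltnW] pq; [exact: H|apply/esym; exact: H].
case: p q => k i [m j] /= km [/= hi [_ /andP[i1 i2]]] [/= hj [hm /andP[j1 j2]]].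
move: km; rewrite leq_eqVlt => /predU1P[km|km].
  subst m; congr pair; apply/eqP; rewrite eqn_leq; apply/andP; split.
    rewrite leqNgt; apply/negP => ji; have := le_brk k _ _ ji; lra.
  by rewrite leqNgt; apply/negP => ji; have := le_brk k _ _ ji; lra.
have oS : offset k.+1 x = offset k x.
  by rewrite /= leNgt (lt_le_trans i2) ?le_brk.
by exfalso; have := hm _ km; have := width_brk k i; lra.
Qed.

Lemma node_offset k (c x : R) : node k c -> c <= x < c + width k ->
  (forall i, (i <= k)%N -> offset i x < width i) /\ offset k x = x - c.
Proof.
move=> kc; elim: kc x => [|{}k {}c _ IH|{}k {}c _ IH] x /andP[h1 h2].
- rewrite add0r in h2; split; last by rewrite subr0.
  by move=> i; rewrite leqn0 => /eqP->.
- have [|oi ok] := IH x.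
    by have := widthS_le k; lra.
  have ok1 : offset k.+1 x = x - c.
    by rewrite /= ok; case: ifP => //; have := width_lt_gap_end k;
       have := width_gt0 k.+1; lra.
  split=> // i; rewrite leq_eqVlt => /predU1P[->|]; last exact: oi.
  by rewrite ok1; lra.
- have wk := widthE k; have sk := gap_end_gt0 k.
  have [|oi ok] := IH x; first lra.
  have ok1 : offset k.+1 x = x - (c + gap_end k).
    by rewrite /= ok; case: ifPn; lra.
  split=> // i; rewrite leq_eqVlt => /predU1P[->|]; last exact: oi.
  by rewrite ok1; lra.
Qed.

Lemma node_piece k (c : R) j (x : R) : node k c -> (j <= last_piece k)%N ->
  c + brk k j <= x < c + brk k j.+1 -> piece (k, j) x.
Proof.
move=> kc jk /andP[h1 h2].
have b0 := brk_gt0 k j; have bs := le_brk k j.+1 (last_piece k).+1 jk.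
have w0 := width_gt0 k.+1.
have [|oi ok] := node_offset k c x kc.
  by rewrite (widthE k) /gap_end; lra.
by split=> //; split=> //=; rewrite ok; lra.
Qed.

End Scheme.

Arguments growth {R} k.
Arguments width {R} k.
Arguments brk {R} k j.
Arguments gap_end {R} k.
Arguments node {R} _ _.
Arguments offset {R} k x.
Arguments piece {R} p _.

(** * Directions of the curve at a given scale *)

Section Curve.
Context {R : realType} {V : lmodType R} {N : V -> R} (hN : is_norm N).
Context {g : R -> V} {K L : R} {w : nat -> nat -> V} {w0 v : V}.
Hypotheses (K0 : 0 <= K) (L0 : 0 <= L).
Hypothesis g_lip : forall s t : R, 0 <= s <= t -> N (g t - g s) <= K * (t - s).
Hypothesis g_piece : forall k (c : R) j (s t : R), node k c -> (j <= last_piece k)%N ->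
  c + brk k j <= s -> s <= t -> t <= c + brk k j.+1 ->
  g t - g s = (t - s) *: w k j.
Hypothesis w_unit : forall k j, (j <= last_piece k)%N -> N (w k j) = 1.
Hypothesis w_first : forall k, w k 0%N = w0.
Hypothesis w_last : forall k, w k (last_piece k) = w0.
Hypothesis w_mid : forall k, w k k.+2 = v.
Hypothesis w_slow : forall k j, (j < last_piece k)%N ->
  N (w k j.+1 - w k j) <= L / growth k.
Hypothesis w0_v : N (w0 + v) <= 1.

(* How far the increment of [g] over [s, t] is from that of a unit-speed segment of
   direction [u]. *)
Definition dev (s t : R) (u : V) : R := N (g t - g s - (t - s) *: u).

(** Relative error at stage [k]: [4 * (K + 1)] pays for the stretches estimated crudely, [L] for the
    change of direction between consecutive pieces. *)
Definition err (k : nat) : R := (4 * (K + 1) + L) / growth k.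

Lemma dev_trans (t s r : R) u : dev s r u <= dev s t u + dev t r u.
Proof.
apply: le_trans _ (isnorm_triangle hN _ _).
rewrite addrACA [X in X + _]addrC subrKA -opprD -scalerDl.
by rewrite [X in X *: u]addrC subrKA.
Qed.

Lemma N_w0 : N w0 = 1. Proof. by rewrite -(w_first 0) w_unit. Qed.

Lemma N_v : N v = 1.
Proof. by rewrite -(w_mid 0) w_unit// /last_piece -addnn leq_addr. Qed.

Lemma dev_crude (s t : R) u : 0 <= s <= t -> N u = 1 -> dev s t u <= (K + 1) * (t - s).
Proof.
move=> /[dup] st /andP[_ st'] Nu; apply: le_trans (isnorm_triangle hN _ _) _.
rewrite (isnormN hN) (isnormZ hN) Nu mulr1 ger0_norm ?subr_ge0//.
by have := g_lip _ _ st; lra.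
Qed.

Lemma dev_change (s t : R) u u' : s <= t ->
  dev s t u <= dev s t u' + (t - s) * N (u - u').
Proof.
move=> st; rewrite -[t - s in X in _ <= _ + X]ger0_norm ?subr_ge0//.
rewrite -(isnormZ hN) -(isnormN hN ((t - s) *: _)).
apply: le_trans _ (isnorm_triangle hN _ _).
by rewrite scalerBr opprB addrA subrK.
Qed.

Lemma dev_piece k (c : R) j (s t : R) : node k c -> (j <= last_piece k)%N ->
  c + brk k j <= s -> s <= t -> t <= c + brk k j.+1 -> dev s t (w k j) = 0.
Proof.
by move=> kc jk h1 h2 h3; rewrite /dev (g_piece _ _ _ _ _ kc jk)// subrr (isnorm0 hN).
Qed.

Lemma dev_last k (c s t : R) : node k c ->
  c + brk k (last_piece k) <= s -> s <= t -> t <= c + gap_end k -> dev s t w0 = 0.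
Proof. by move=> kc *; rewrite -(w_last k); apply: dev_piece kc _ _ _ _. Qed.

Lemma K1_ge0 : 0 <= K + 1. Proof. by rewrite addr_ge0. Qed.

Lemma err_ge0 k : 0 <= err k.
Proof.
by rewrite divr_ge0 ?addr_ge0 ?mulr_ge0 ?K1_ge0// ltW// growth_gt0 R.
Qed.

Lemma errS k : err k.+1 <= err k.
Proof.
rewrite ler_pdivrMr ?(growth_gt0 R)// /err mulrAC ler_pdivlMr ?(growth_gt0 R)//.
by rewrite ler_wpM2l ?ler_nat// addr_ge0 ?mulr_ge0 ?K1_ge0.
Qed.

Lemma le_errS k (a d : R) : 0 <= d -> a <= err k.+1 * d -> a <= err k * d.
Proof. by move=> d0 /le_trans; apply; rewrite ler_wpM2r// errS. Qed.

Lemma err_absorb k (b d : R) : 0 <= b -> growth k * b <= 2 * d ->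
  2 * ((K + 1) * b) + L / growth k * d <= err k * d.
Proof.
move=> b0 h; rewrite /err [in leRHS]mulrDl mulrDl lerD2r.
rewrite [leRHS]mulrAC ler_pdivlMr ?(growth_gt0 R)//.
have -> : 2 * ((K + 1) * b) * growth k = 2 * (K + 1) * (growth k * b) by ring.
have -> : 4 * (K + 1) * d = 2 * (K + 1) * (2 * d) by ring.
by rewrite ler_wpM2l// mulr_ge0 ?K1_ge0.
Qed.

(** The last piece, of direction [w0], dominates: the stretches before and after it have length at
    most [brk k (last_piece k)], while [y - x] is at least [growth k / 2] times that. *)
Lemma dev_span k (c x y : R) : node k c ->
  c <= x <= c + brk k (last_piece k) -> c + gap_end k <= y <= c + width k ->
  dev x y w0 <= err k * (y - x).
Proof.
move=> kc /andP[x1 x2] /andP[y1 y2]; have [c0 _] := node_bounds R k c kc.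
have bs : 2 * brk k (last_piece k) <= gap_end k := brkS_ge2 R k (last_piece k).
have bq : gap_end k = growth k * brk k (last_piece k) := brkS R k (last_piece k).
have wb := width_brk R k (last_piece k); have b0 := brk_gt0 R k (last_piece k).
have wE := widthE R k.
have h0 : dev (c + brk k (last_piece k)) (c + gap_end k) w0 = 0.
  by apply: dev_last kc _ _ _; lra.
set b := brk k (last_piece k) in x2 bs bq wb b0 h0 *.
have h1 := dev_trans (c + b) x y w0.
have h2 := dev_trans (c + gap_end k) (c + b) y w0.
have h3 : dev x (c + b) w0 <= (K + 1) * (c + b - x).
  by apply: dev_crude N_w0; lra.
have h4 : dev (c + gap_end k) y w0 <= (K + 1) * (y - (c + gap_end k)).
  by apply: dev_crude N_w0; lra.
apply: le_trans (err_absorb k b (y - x) _ _); [|lra..].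
have h5 : 0 <= L / growth k * (y - x).
  by rewrite mulr_ge0 ?divr_ge0 ?(ltW (growth_gt0 R _))//; lra.
have h6 : (K + 1) * (y - (c + gap_end k)) <= (K + 1) * b.
  by rewrite ler_wpM2l ?K1_ge0//; lra.
have h7 : (K + 1) * (c + b - x) <= (K + 1) * b.
  by rewrite ler_wpM2l ?K1_ge0//; lra.
have h8 := le_trans h3 h7; have h9 := le_trans h4 h6.
set p := (K + 1) * b in h8 h9 *; set l := _ * (y - x) in h5 *; lra.
Qed.

Lemma le_errM k (d d' : R) : d <= d' -> err k * d <= err k * d'.
Proof. by move=> dd; rewrite ler_wpM2l ?err_ge0. Qed.

Lemma dev_to_end k (c x : R) : node k c -> c <= x < c + width k ->
  dev x (c + width k) w0 <= err k * (c + width k - x).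
Proof.
move=> kc /andP[cx xc].
(* [n] bounds the descent: at [n = 0] the interval would be shorter than the distance from [x] to
   its end. *)
have [|n /(_ k)] := width_small R (c + width k - x); first lra.
elim: n k c kc cx xc => [|n IH] k c kc cx xc.
  by rewrite addn0; lra.
rewrite addnS -addSn => xn.
have wE := widthE R k; have w1 := width_gt0 R k.+1.
have [xb|bx] := leP x (c + brk k (last_piece k)).
  by apply: dev_span kc _ _; lra.
have eE : c + width k = c + gap_end k + width k.+1 by lra.
have kcR := nodeR R _ _ kc.
(* In the right interval the induction applies; from the last piece, the rest of the gap is exact
   and the right interval is spanned from its own left end. *)
have [xs|sx] := leP x (c + gap_end k); last first.
  by rewrite eE in xn xc *; apply: le_errS; [lra|apply: IH => //; lra].
have h1 := dev_trans (c + gap_end k) x (c + width k) w0.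
have h0 : dev x (c + gap_end k) w0 = 0 by apply: dev_last kc _ _ _; lra.
have h2 : dev (c + gap_end k) (c + width k) w0 <=
    err k.+1 * (c + width k - (c + gap_end k)).
  have g1 := gap_end_gt0 R k.+1; have b1 := brk_gt0 R k.+1 (last_piece k.+1).
  have wE1 := widthE R k.+1; have w2 := width_gt0 R k.+2.
  by apply: dev_span kcR _ _; lra.
have h3 : dev (c + gap_end k) (c + width k) w0 <=
    err k * (c + width k - (c + gap_end k)) by apply: le_errS => //; lra.
have := le_errM k (c + width k - (c + gap_end k)) (c + width k - x).
lra.
Qed.

Lemma dev_across_gap k (c x y : R) : node k c ->
  c <= x < c + width k.+1 -> c + width k.+1 <= y <= c + width k ->
  exists2 u, N u = 1 & dev x y u <= err k * (y - x).
Proof.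
move=> kc /andP[cx xc] /andP[cy yc].
have w1 := width_gt0 R k.+1; have wE := widthE R k.
have [c0 _] := node_bounds R k c kc.
have [sy|ys] := leP (c + gap_end k) y.
  exists w0; first exact: N_w0.
  by have wb := width_brk R k (last_piece k); apply: dev_span kc _ _; lra.
have [|[|j] jk /andP[jy yj]] := brk_locate R k c y (last_piece k).+1.
- by rewrite brk0 cy.
- exists w0; first exact: N_w0.
  rewrite brk0 in jy.
  have h1 := dev_trans (c + width k.+1) x y w0.
  have h2 : dev x (c + width k.+1) w0 <= err k.+1 * (c + width k.+1 - x).
    by apply: dev_to_end; [exact: nodeL|lra].
  have h0 : dev (c + width k.+1) y w0 = 0.
    rewrite -(w_first k); apply: dev_piece kc _ _ _ _ => //; rewrite ?brk0; lra.
  have h3 : dev x (c + width k.+1) w0 <= err k * (c + width k.+1 - x).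
    by apply: le_errS => //; lra.
  by have := le_errM k (c + width k.+1 - x) (y - x); lra.
(* Pieces [j] and [j.+1] together dominate and nearly share a direction; what precedes them has
   length at most [brk k j], hence at most [2 / growth k] times [y - x]. *)
- have {}jk : (j.+1 <= last_piece k)%N by [].
  exists (w k j.+1); first exact: w_unit.
  have h1 := dev_trans (c + brk k j) x y (w k j.+1).
  have h2 := dev_trans (c + brk k j.+1) (c + brk k j) y (w k j.+1).
  have h0 : dev (c + brk k j.+1) y (w k j.+1) = 0.
    by apply: dev_piece kc _ _ _ _ => //; lra.
  have b0 := brk_gt0 R k j; have wb := width_brk R k j.
  have bs := brkS_ge2 R k j; have bq := brkS R k j.
  have h3 : dev x (c + brk k j) (w k j.+1) <= (K + 1) * (c + brk k j - x).
    by apply: dev_crude; [lra|exact: w_unit].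
  have h4 := dev_change (c + brk k j) (c + brk k j.+1) (w k j.+1) (w k j).
  have h5 : dev (c + brk k j) (c + brk k j.+1) (w k j) = 0.
    by apply: dev_piece kc _ _ _ _ => //; [exact: ltnW|lra].
  have h6 : (c + brk k j.+1 - (c + brk k j)) * N (w k j.+1 - w k j) <=
      L / growth k * (y - x).
    rewrite [leRHS]mulrC; apply: ler_pM; [lra|exact: isnorm_ge0|lra|exact: w_slow].
  have h7 : (K + 1) * (c + brk k j - x) <= (K + 1) * brk k j.
    by rewrite ler_wpM2l ?K1_ge0//; lra.
  have h8 : 0 <= (K + 1) * brk k j by rewrite mulr_ge0 ?K1_ge0// ltW.
  apply: le_trans (err_absorb k (brk k j) (y - x) _ _); [|lra..].
  have h9 := le_trans h3 h7.
  have {}h4 : dev (c + brk k j) (c + brk k j.+1) (w k j.+1) <= L / growth k * (y - x).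
    by apply: le_trans (h4 _) _; [lra|rewrite h5 add0r].
  set p := (K + 1) * brk k j in h8 h9 *; set l := _ * (y - x) in h4 *; lra.
Qed.

(** [x] avoids all gaps, taken closed on the left and open on the right: a point of such a gap has
    an affine stretch of the curve just to its right. *)
Definition right_limit_point (x : R) := forall k (c : R), node k c ->
  c <= x < c + width k -> x < c + width k.+1 \/ c + gap_end k <= x.

Lemma right_limit_point_node (x : R) k : right_limit_point x -> 0 <= x < 1 ->
  exists2 c, node k c & c <= x < c + width k.
Proof.
move=> gx x01; elim: k => [|k [c kc xc]].
  by exists 0; [exact: node0|rewrite add0r].
have wE := widthE R k.
case: (gx _ _ kc xc) => h; first by exists c; [exact: nodeL|lra].
by exists (c + gap_end k); [exact: nodeR|lra].
Qed.

(** Descend through the intervals containing [x] until [x] lies in a left interval that [y] has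
    left; there [dev_across_gap] applies. The direction [u] may depend on [y]. *)
Lemma dev_right k (c x y : R) : right_limit_point x -> node k c ->
  c <= x < c + width k -> x < y <= c + width k ->
  exists2 u, N u = 1 & dev x y u <= err k * (y - x).
Proof.
move=> gx kc xc /andP[xy yc].
have [|n /(_ k)] := width_small R (y - x); first lra.
elim: n k c kc xc yc => [|n IH] k c kc xc yc; first by rewrite addn0; lra.
rewrite addnS -addSn => xn; have wE := widthE R k.
have up u : dev x y u <= err k.+1 * (y - x) -> dev x y u <= err k * (y - x).
  by apply: le_errS; lra.
case: (gx _ _ kc xc) => h.
  have [cy|] := ltP y (c + width k.+1); last by move=> cy; apply: dev_across_gap kc _ _; lra.
  have [||u Nu du] := IH _ _ (nodeL R _ _ kc) _ _ xn; [lra..|].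
  by exists u => //; exact: up.
have [||u Nu du] := IH _ _ (nodeR R _ _ kc) _ _ xn; [lra..|].
by exists u => //; exact: up.
Qed.

Definition left_limit_point (x : R) := forall k (c : R), node k c ->
  c < x <= c + width k -> x <= c + width k.+1 \/ c + gap_end k < x.

Lemma left_limit_point_node (x : R) k : left_limit_point x -> 0 < x <= 1 ->
  exists2 c, node k c & c < x <= c + width k.
Proof.
move=> gx x01; elim: k => [|k [c kc xc]].
  by exists 0; [exact: node0|rewrite add0r].
have wE := widthE R k.
case: (gx _ _ kc xc) => h; first by exists c; [exact: nodeL|lra].
by exists (c + gap_end k); [exact: nodeR|lra].
Qed.

Lemma dev_from_start k (c x : R) : left_limit_point x -> node k c ->
  c < x <= c + width k -> dev c x w0 <= err k * (x - c).
Proof.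
move=> gx kc xc.
have [|n /(_ k)] := width_small R (x - c); first lra.
elim: n k kc xc => [|n IH] k kc xc; first by rewrite addn0; lra.
rewrite addnS -addSn => xn; have b0 := brk_gt0 R k (last_piece k).
case: (gx _ _ kc xc) => h.
  by apply: le_errS; [lra|apply: IH => //; [exact: nodeL|lra]].
by apply: dev_span kc _ _; lra.
Qed.

(** Looking back from [x], the direction is [w0] at every scale, since each right interval is
    preceded by a long last piece. *)
Lemma dev_left k (c x y : R) : left_limit_point x -> node k c ->
  c < x <= c + width k -> c <= y < x -> dev y x w0 <= err k * (x - y).
Proof.
move=> gx kc xc /andP[cy yx].
have [|n /(_ k)] := width_small R (x - y); first lra.
elim: n k c kc xc cy => [|n IH] k c kc xc cy; first by rewrite addn0; lra.
rewrite addnS -addSn => xn; have wE := widthE R k.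
case: (gx _ _ kc xc) => h.
  by apply: le_errS; [lra|apply: (IH _ c) => //; [exact: nodeL|lra]].
have [yb|bY] := leP y (c + brk k (last_piece k)).
  by apply: dev_span kc _ _; lra.
have kcR := nodeR R _ _ kc.
have [sy|ys] := leP (c + gap_end k) y.
  by apply: le_errS; [lra|apply: (IH _ _ kcR) => //; lra].
have h1 := dev_trans (c + gap_end k) y x w0.
have h0 : dev y (c + gap_end k) w0 = 0 by apply: dev_last kc _ _ _; lra.
have h2 : dev (c + gap_end k) x w0 <= err k.+1 * (x - (c + gap_end k)).
  by apply: dev_from_start => //; lra.
have h3 : dev (c + gap_end k) x w0 <= err k * (x - (c + gap_end k)).
  by apply: le_errS => //; lra.
by have := le_errM k (x - (c + gap_end k)) (x - y); lra.
Qed.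

Lemma err_small (e : R) : 0 < e -> exists k, forall i, (k <= i)%N -> err i <= e.
Proof.
move=> e0; pose E := 4 * (K + 1) + L.
have E0 : 0 <= E by rewrite addr_ge0 ?mulr_ge0 ?K1_ge0.
exists (Num.truncn (E / e)) => i ki.
rewrite /err ler_pdivrMr ?growth_gt0// [leRHS]mulrC -ler_pdivrMr//.
apply: ltW; apply: lt_le_trans (truncnS_gt _) _.
by rewrite /growth ler_nat ltnS (leq_trans ki).
Qed.

(** * Metric derivatives and corners *)

(** By the reverse triangle inequality, closeness to [t *: u] controls the norm of the increment
    whatever the unit vector, so [u] may vary with [t]. *)
Lemma is_mdr_approx (f : R -> V) (x : R) :
  (forall e : R, 0 < e -> exists2 d : R, 0 < d & forall t : R, 0 < t < d ->
    exists2 u, N u = 1 & N (f (x + t) - f x - t *: u) <= e * t) ->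
  is_mdr N f x 1.
Proof.
move=> H; apply/cvgrPdist_le => e e0; have [d d0 h] := H e e0.
near=> t.
have t0 : 0 < t by near: t; exact: nbhs_right_gt.
have td : t < d by near: t; exact: nbhs_right_lt.
have [u Nu hu] : exists2 u, N u = 1 & N (f (x + t) - f x - t *: u) <= e * t.
  by apply: h; rewrite t0.
rewrite -(ler_pM2r t0) -[X in _ * X <= _](gtr0_norm t0) -normrM mulrBl mul1r.
rewrite divfK ?lt0r_neq0//; apply: le_trans hu.
apply: le_trans (isnorm_dist hN _ _); rewrite distrC (isnormZ hN) Nu mulr1.
by rewrite [`|t|]gtr0_norm.
Unshelve. all: by end_near. Qed.

Lemma is_mdl_approx (f : R -> V) (x : R) :
  (forall e : R, 0 < e -> exists2 d : R, 0 < d & forall t : R, 0 < t < d ->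
    exists2 u, N u = 1 & N (f x - f (x - t) - t *: u) <= e * t) ->
  is_mdl N f x 1.
Proof.
move=> H; suff : is_mdr N (fun s => f (- s)) (- x) 1.
  by rewrite /is_mdr /is_mdl; under eq_fun do rewrite opprD opprK.
apply: is_mdr_approx => e /H[d d0 h]; exists d => // t /h[u Nu hu].
exists (- u); first by rewrite (isnormN hN).
rewrite opprD !opprK scalerN opprK -(isnormN hN) opprD opprB.
exact: hu.
Qed.

Lemma curve_mdr (x : R) : 0 <= x < 1 -> is_mdr N g x 1.
Proof.
move=> x01; apply: is_mdr_approx => e e0.
have [gx|] := pselect (right_limit_point x).
  have [k /(_ k (leqnn k)) ke] := err_small e e0.
  have [c kc xc] := right_limit_point_node x k gx x01.
  exists (c + width k - x) => [|t t0]; first lra.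
  have [||u Nu hu] := dev_right k c x (x + t) gx kc; [lra..|].
  exists u => //; move: hu; rewrite /dev [x + t - x]addrC addKr => /le_trans; apply.
  by rewrite ler_pM2r//; lra.
(* Otherwise [x] lies in a gap, and the curve is affine on the rest of its piece. *)
move=> /existsNP[k] /existsNP[c] /not_implyP[kc] /not_implyP[xc].
move=> /not_orP[/negP h1 /negP h2]; rewrite -leNgt in h1; rewrite -ltNge in h2.
have [|j jk xj] := brk_locate R k c x (last_piece k).+1.
  by rewrite brk0 h1.
exists (c + brk k j.+1 - x) => [|t t0]; first lra.
exists (w k j); first exact: w_unit.
have := dev_piece k c j x (x + t) kc jk; rewrite /dev [x + t - x]addrC addKr => ->; try lra.
by rewrite mulr_ge0//; lra.
Qed.

Lemma curve_mdl (x : R) : 0 < x <= 1 -> is_mdl N g x 1.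
Proof.
move=> x01; apply: is_mdl_approx => e e0.
have [gx|] := pselect (left_limit_point x).
  have [k /(_ k (leqnn k)) ke] := err_small e e0.
  have [c kc xc] := left_limit_point_node x k gx x01.
  exists (x - c) => [|t t0]; first lra.
  have hu := dev_left k c x (x - t) gx kc.
  exists w0; first exact: N_w0.
  have {}hu : dev (x - t) x w0 <= err k * (x - (x - t)) by apply: hu; lra.
  have tE : x - (x - t) = t by ring.
  move: hu; rewrite /dev tE => /le_trans; apply.
  by rewrite ler_pM2r//; lra.
move=> /existsNP[k] /existsNP[c] /not_implyP[kc] /not_implyP[xc].
move=> /not_orP[/negP h1 /negP h2]; rewrite -ltNge in h1; rewrite -leNgt in h2.
have [|j jk xj] := brk_locate_left R k c x (last_piece k).+1.
  by rewrite brk0 h1.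
exists (x - (c + brk k j)) => [|t t0]; first lra.
exists (w k j); first exact: w_unit.
have h := dev_piece k c j (x - t) x kc jk.
have {}h : dev (x - t) x (w k j) = 0 by apply: h; lra.
have tE : x - (x - t) = t by ring.
by move: h; rewrite /dev tE => ->; rewrite mulr_ge0//; lra.
Qed.

Lemma curve_continuous : norm_continuous_on N 0 1 g.
Proof.
move=> x; rewrite in_itv/= => x01; apply/cvgrPdist_le => e e0.
have K1 : 0 < K + 1 by rewrite ltr_wpDl.
have gd (y : R) : 0 <= y <= 1 -> N (g y - g x) <= (K + 1) * `|x - y|.
  move=> y01; apply: (@le_trans _ _ (K * `|x - y|)); last first.
    by rewrite ler_wpM2r// lerDl.
  case: (lerP y x) => xy; last by apply: g_lip; lra.
  by rewrite (isnorm_distC hN); apply: g_lip; lra.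
apply/nbhs_ballP; exists (e / (K + 1)); first by rewrite /= divr_gt0.
move=> y; rewrite -ball_normE /= => xy; rewrite in_itv/= => y01.
rewrite sub0r normrN ger0_norm ?(isnorm_ge0 hN)//.
apply: le_trans (gd _ y01) _.
by rewrite mulrC -ler_pdivlMr// ltW.
Qed.

(** Before the left end of a right interval the direction is [w0]; after it, at scale [T], it is
    mostly [v]. The increment across is close to [T *: (w0 + v)], of norm at most [T], where metric
    differentiability would call for nearly [2 * T]. *)
Lemma corner_defect k c : node k c -> 2 * (K + 1) <= growth k.+1 ->
  exists T : R, [/\ width k.+2 <= T <= width k.+1,
    0 <= c + gap_end k - T, c + gap_end k + T <= 1 &
    N (g (c + gap_end k + T) - g (c + gap_end k - T)) <= 3 / 2 * T].
Proof.
move=> kc Kq; have kcR := nodeR R _ _ kc.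
have [c0 c1] := node_bounds R _ _ kc.
have mk : (k.+3 <= last_piece k.+1)%N by rewrite /last_piece -addnn leq_addr.
pose p := c + gap_end k; rewrite -/p in kcR *.
(* By [w_mid] at stage [k.+1], the piece from [p + b] to [p + T] has direction [v], and [b] is only
   [T / growth k.+1]. *)
pose b := brk (R := R) k.+1 k.+3; pose T := brk (R := R) k.+1 k.+4.
have Tb : T = growth k.+1 * b by exact: brkS.
have b0 : 0 < b by exact: brk_gt0.
have bT : b <= T by exact: le_brk.
have wT : width k.+2 <= T by exact: width_brk.
have w0' := width_gt0 R k.+2.
have Tw : T <= width k.+1.
  have : T <= gap_end k.+1 by exact: le_brk.
  by rewrite (widthE R k.+1); lra.
have wb := width_brk R k (last_piece k).
have bs : 2 * brk k (last_piece k) <= gap_end k := brkS_ge2 R k (last_piece k).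
have wE := widthE R k.
exists T; split; [by rewrite wT|rewrite /p; lra|rewrite /p; lra|].
(* The last piece of the gap is at least as long as the right interval, so it contains [p - T]. *)
have h1 : dev (p - T) p w0 = 0 by apply: dev_last kc _ _ _; rewrite /p; lra.
have h2 : dev p (p + T) v <= (K + 1) * b.
  apply: le_trans (dev_trans (p + b) _ _ _) _.
  have -> : dev (p + b) (p + T) v = 0.
    by rewrite -(w_mid k.+1); apply: dev_piece kcR _ _ _ _ => //; rewrite -/b -/T; lra.
  rewrite addr0 -[X in _ <= _ * X](_ : p + b - p = _); last by ring.
  by apply: dev_crude N_v; rewrite /p; lra.
have -> : g (p + T) - g (p - T) = (g (p + T) - g p - (p + T - p) *: v) +
    ((g p - g (p - T) - (p - (p - T)) *: w0) + T *: (w0 + v)).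
  have -> : p + T - p = T by ring.
  have -> : p - (p - T) = T by ring.
  rewrite scalerDr (addrA (_ - T *: w0)) subrK addrACA addNr addr0.
  by rewrite subrKA.
apply: le_trans (isnorm_triangle hN _ _) _.
have h3 := isnorm_triangle hN (g p - g (p - T) - (p - (p - T)) *: w0) (T *: (w0 + v)).
rewrite (isnormZ hN) ger0_norm in h3; last by lra.
have h4 : T * N (w0 + v) <= T by rewrite ger_pMr//; lra.
have h5 : 2 * (K + 1) * b <= T by rewrite Tb ler_pM2r.
rewrite -!/(dev _ _ _) in h3 *; lra.
Qed.

Lemma not_metrically_differentiable_corners (x : R) :
  (forall n, exists k c, [/\ (n <= k)%N, node k c &
     c + gap_end k <= x <= c + gap_end k + width k.+2]) ->
  ~ metrically_differentiable N 0 1 g x.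
Proof.
move=> H.
have x01 : 0 < x <= 1.
  have [k [c [_ kc xc]]] := H 0%N; have [c0 c1] := node_bounds R _ _ kc.
  have := gap_end_gt0 R k; have := widthE R k; have := widthE R k.+1.
  by have := gap_end_gt0 R k.+1; lra.
case=> m [_ hl] /eqoP ho.
have m1 : m = 1.
  have x0 : 0 < x by lra.
  have hm := hl x0; have h1 := curve_mdl _ x01.
  by rewrite -(cvg_lim _ hm)// -(cvg_lim _ h1).
(* The pair [p + T], [p - T] will have defect at least [T / 2] against a gauge equal to [2 * T]; any
   constant below [1 / 4] gives a contradiction. *)
have /nbhs_ballP[d /= d0 hd] := ho (1 / 7) ltac:(by lra).
have [n1 wn] := width_small R d d0.
(* [n1] puts the test pair within [d] of [x]; [n2] makes the ratio large enough for
   [corner_defect]. *)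
pose n2 := Num.truncn (2 * (K + 1)).
have [k [c [nk kc xc]]] := H (n1 + n2)%N.
have Kq : 2 * (K + 1) <= growth k.+1.
  apply: ltW; apply: lt_le_trans (truncnS_gt _) _; rewrite ler_nat.
  by rewrite -/n2; lia.
have wd : width k < d.
  by rewrite -(subnK (leq_trans (leq_addr _ _) nk)) wn.
have [T [/andP[wT Tw] T0 T1 hT]] := corner_defect k c kc Kq.
have wE := widthE R k; have g0 := gap_end_gt0 R k.
have w2 := width_gt0 R k.+2; have w1 := width_gt0 R k.+1.
have bs := width_lt_gap_end R k.
set p := c + gap_end k in xc T0 T1 hT *.
have pE : p = c + gap_end k by [].
have hb : ball (x, x) d (p + T, p - T).
  by split; rewrite /= -ball_normE /= ltr_norml; lra.
have hD : ([set` `[0, 1]] `*` [set` `[0, 1]]) (p + T, p - T).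
  by split; rewrite /= in_itv /=; lra.
have := hd _ hb hD; rewrite /= m1 mul1r.
have -> : p + T - (p - T) = 2 * T by ring.
rewrite (ger0_norm (_ : 0 <= 2 * T)); last lra.
rewrite (ger0_norm (_ : 0 <= p + T - x)); last lra.
rewrite (ler0_norm (_ : p - T - x <= 0)); last lra.
rewrite [X in _ <= _ * X]ger0_norm; last lra.
by rewrite ler_norml => /andP[]; lra.
Qed.

(** Cantor's diagonal argument: an injection into the naturals lists the exceptional points, and
    nested intervals yield an exceptional point outside the list. *)
Lemma uncountable_not_metrically_differentiable :
  ~ countable [set x : R | x \in `[0, 1] /\ ~ metrically_differentiable N 0 1 g x].
Proof.
set S := mkset _ => /countable_injP[f finj].
(* [pick] enumerates the exceptional set; the third step of each block of three
   stages chooses the child interval that avoids [pick i]. *)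
pose pick i := xget 0 [set x | S x /\ f x = i].
(* A right step and then a left step keep the limit point within [width (i * 3).+2] of the corner
   [start i c]; the third step is free for the diagonal choice. *)
pose start (i : nat) (c : R) := c + gap_end (i * 3)%N.
pose next (i : nat) (c : R) := if pick i <= start i c + width (i.+1 * 3)
  then start i c + gap_end (i * 3).+2 else start i c.
pose C := fix C (i : nat) : R := if i is j.+1 then next j (C j) else 0.
have CS i : C i.+1 = next i (C i) by [].
have nC i : node (i * 3)%N (C i).
  elim: i => [|i IH]; first exact: node0.
  rewrite CS /next; case: ifP => _; [apply: nodeR|apply: nodeL];
    by apply: nodeL; apply: nodeR.
have w3 i : width (i.+1 * 3) = width (R := R) (i * 3).+3 by [].
have CS2 i : start i (C i) <= C i.+1 /\
    C i.+1 + width (i.+1 * 3) <= start i (C i) + width (i * 3).+2.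
  rewrite CS /next w3; have := widthE R (i * 3).+2.
  by have := gap_end_gt0 R (i * 3).+2; case: ifP => _; lra.
have w_end i : start i (C i) + width (i * 3).+2 <= C i + width (i * 3).
  by rewrite /start; have := widthE R (i * 3); have := widthS_le R (i * 3).+1; lra.
have Ci i j : C i <= C (i + j)%N /\
    C (i + j)%N + width ((i + j) * 3) <= C i + width (i * 3).
  elim: j => [|j [IH1 IH2]]; first by rewrite addn0.
  rewrite addnS; have := CS2 (i + j)%N; have := w_end (i + j)%N.
  by have := gap_end_gt0 R ((i + j) * 3); rewrite /start; lra.
have Cub i j : C j <= C i + width (i * 3).
  have := width_gt0 R (i * 3); have := width_gt0 R (j * 3).
  have [ij|/ltnW ij] := leqP i j.
    by have := Ci i (j - i)%N; rewrite subnKC//; lra.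
  by have := Ci j (i - j)%N; rewrite subnKC//; lra.
pose x := sup (range C).
have Cx i : C i <= x <= C i + width (i * 3).
  have ub : ubound (range C) (C i + width (i * 3)) by move=> _ [j _ <-].
  apply/andP; split; last by apply: ge_sup => //; exists (C 0%N), 0%N.
  by apply: ub_le_sup; [exists (C i + width (i * 3))|exists i].
have Sx : S x.
  split; first by rewrite in_itv/=; have := Cx 0%N; rewrite add0r.
  apply: not_metrically_differentiable_corners => n.
  exists (n * 3)%N, (C n); split; [by rewrite leq_pmulr|exact: nC|].
  by have := Cx n.+1; have := CS2 n; rewrite /start; lra.
(* [x] itself attains the value [f x], so [pick (f x)] is not the default; by injectivity it equals
   [x], which block [f x] was built to avoid. *)
have [Sp fp] : [set y | S y /\ f y = f x] (pick (f x)).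
  by apply: xgetPex; exists x.
have px : pick (f x) = x by apply: finj => //; rewrite inE.
have := Cx (f x).+1; rewrite CS /next px w3.
case: (leP x (start _ _ + _)) => xs; last by have := width_gt0 R (f x * 3).+3; lra.
by have := width_lt_gap_end R (f x * 3).+2; have := width_gt0 R (f x * 3).+3; lra.
Qed.

End Curve.

(** * * Choice of the directions and assembly of the curve *)

Lemma isnorm_le_coord {R : realType} {n : nat} {N : 'rV[R]_n -> R} (m : R) (x : 'rV[R]_n) :
  is_norm N -> (forall i, `|x 0 i| <= m) ->
  N x <= m * \sum_i N (delta_mx 0 i).
Proof.
move=> hN xm; rewrite [in leLHS](row_sum_delta x) mulr_sumr.
have : N (\sum_i x 0 i *: delta_mx 0 i) <= \sum_i N (x 0 i *: delta_mx 0 i).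
  elim/big_ind2: _ => [|u a u' a' ha ha'|i _]; rewrite ?(isnorm0 hN)//.
  exact: le_trans (isnorm_triangle hN _ _) (lerD ha ha').
move=> /le_trans; apply; apply: ler_sum => i _.
by rewrite (isnormZ hN) ler_wpM2r// (isnorm_ge0 hN).
Qed.

(** The arc parameter of piece [j]: it climbs from 0 to 1 at [j = k.+2] and returns to 0 at
    [last_piece k], by steps of at most [1 / growth k]. *)
Definition tent {R : realType} (k j : nat) : R :=
  1 - `|j%:R - growth k| / growth k.

Section Tent.
Context (R : realType).

Lemma tent_itv k j : (j <= last_piece k)%N -> 0 <= tent (R := R) k j <= 1.
Proof.
move=> jk; have q0 := growth_gt0 R k.
have h : `|j%:R - growth k| <= growth k :> R.
  have j2 : j%:R <= growth k + growth k :> R.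
    by rewrite -natrD ler_nat addnn.
  have j0 : 0 <= j%:R :> R by [].
  by rewrite ler_norml; lra.
by rewrite subr_ge0 ler_pdivrMr// mul1r h lerBlDr lerDl divr_ge0// ltW.
Qed.

Lemma tent_first k : tent (R := R) k 0 = 0.
Proof.
have q0 := growth_gt0 R k.
by rewrite /tent sub0r normrN gtr0_norm// divff ?subrr// lt0r_neq0.
Qed.

Lemma tent_last k : tent (R := R) k (last_piece k) = 0.
Proof.
have q0 := growth_gt0 R k; rewrite /tent /last_piece -addnn natrD addrK gtr0_norm//.
by rewrite divff ?subrr// lt0r_neq0.
Qed.

Lemma tent_mid k : tent (R := R) k k.+2 = 1.
Proof. by rewrite /tent subrr normr0 mul0r subr0. Qed.

Lemma tent_step k j : `|tent k j.+1 - tent k j| <= (growth k)^-1 :> R.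
Proof.
have q0 := growth_gt0 R k.
rewrite /tent opprB addrC subrKA -mulrBl normrM [X in _ * X]gtr0_norm ?invr_gt0//.
rewrite ler_piMl ?invr_ge0 ?(ltW q0)//; apply: le_trans (ler_dist_dist _ _) _.
by rewrite (_ : _ - _ = -1) ?normrN1//; rewrite -natr1; ring.
Qed.

End Tent.

Theorem theorem4p9 (R : realType) (N : 'rV[R]_2 -> R) (hN : is_norm N) :
  exists (l : R) (gamma : R -> 'rV[R]_2),
    [/\ 0 < l,
        norm_continuous_on N 0 l gamma,
        (forall x : R, x \in `[0, l] -> is_md N 0 l gamma x 1) &
        ~ countable [set x : R | x \in `[0, l] /\
                                 ~ metrically_differentiable N 0 l gamma x]].
Proof.
have [e [v [Ne Nv ev0 ev1]]] := unit_pair_sum_le1 R N hN.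
pose w k j := unit_arc (N := N) e v (tent k j).
have NeV := isnorm_gt0 hN _ ev0.
(* Normalizing divides a chord vector by at least [N (e + v) / 4]; the sum bounds each coordinate of
   the chord. *)
pose M := 4 / N (e + v) * \sum_i (`|e 0 i| + `|v 0 i|).
have sum0 : 0 <= \sum_i (`|e 0 i| + `|v 0 i|).
  by apply: sumr_ge0 => i _; rewrite addr_ge0.
have M0 : 0 <= M by rewrite mulr_ge0// divr_ge0// ltW.
have arcM x i : 0 <= x <= 1 -> `|unit_arc (N := N) e v x 0 i| <= M.
  move=> /[dup] x01 /andP[x0 x1].
  have cx := isnorm_chord hN e v Ne Nv x x01.
  have c0 : 0 < N (chord e v x) by lra.
  rewrite mxE normrM gtr0_norm ?invr_gt0//.
  apply: ler_pM => //; first by rewrite invr_ge0 ltW.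
    by rewrite -[4 / _]invrK invf_div lef_pV2 ?posrE ?divr_gt0.
  rewrite (bigD1 i)//= -[leLHS]addr0; apply: lerD; last first.
    by apply: sumr_ge0 => j _; rewrite addr_ge0.
  rewrite !mxE; apply: le_trans (ler_normD _ _) _; rewrite !normrM.
  by apply: lerD; rewrite ler_piMl// ger0_norm; lra.
(* Indices past [last_piece] have empty pieces; the value 0 keeps the bound [M] valid for every
   pair. *)
pose u (p : nat * nat) := if (p.2 <= last_piece p.1)%N then w p.1 p.2 else 0.
have uM p i : `|u p 0 i| <= M.
  rewrite /u; case: ifP => [h|_]; last by rewrite mxE normr0.
  exact/arcM/tent_itv.
have [g [g_coord g_lin]] :=
  exists_step_curve piece u M (measurable_piece R) (piece_inj R) M0 uM.
pose K := M * \sum_i N (delta_mx 0 i); pose L := 16 / N (e + v).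
have K0 : 0 <= K by rewrite mulr_ge0// sumr_ge0// => i _; exact: isnorm_ge0.
have L0 : 0 <= L by rewrite divr_ge0// ltW.
have g_lip (s t : R) : 0 <= s <= t -> N (g t - g s) <= K * (t - s).
  move=> st; rewrite /K mulrAC; apply: isnorm_le_coord => // i.
  exact: g_coord.
have g_piece k (c : R) j (s t : R) : node k c -> (j <= last_piece k)%N ->
    c + brk k j <= s -> s <= t -> t <= c + brk k j.+1 ->
    g t - g s = (t - s) *: w k j.
  move=> kc jk js st tj; have [c0 _] := node_bounds R _ _ kc.
  have b0 := brk_gt0 R k j.
  rewrite (g_lin (k, j)) ?/u ?jk//; first lra.
  by move=> x xst; apply: node_piece kc jk _; lra.
have w_unit k j : (j <= last_piece k)%N -> N (w k j) = 1.
  by move=> jk; apply: isnorm_unit_arc => //; exact: tent_itv.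
have w_first k : w k 0%N = e by rewrite /w tent_first unit_arc0.
have w_last k : w k (last_piece k) = e by rewrite /w tent_last unit_arc0.
have w_mid k : w k k.+2 = v by rewrite /w tent_mid unit_arc1.
have w_slow k j : (j < last_piece k)%N -> N (w k j.+1 - w k j) <= L / growth k.
  move=> jk; apply: le_trans (unit_arc_lipschitz hN e v Ne Nv ev0 _ _ _ _) _.
  - exact: tent_itv.
  - exact/tent_itv/ltnW.
  by rewrite ler_wpM2l// tent_step.
exists 1, g; split=> //.
- exact (curve_continuous hN K0 g_lip).
- move=> x; rewrite in_itv/= => /andP[x0 x1]; split=> h.
    apply: (curve_mdr hN K0 L0 g_lip g_piece w_unit w_first w_last w_slow x).
    by rewrite x0.
  apply: (curve_mdl hN K0 L0 g_lip g_piece w_unit w_first w_last x).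
  by rewrite h.
- exact: (uncountable_not_metrically_differentiable hN K0 L0 g_lip g_piece
    w_unit w_first w_last w_mid ev1).
Qed.
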